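(* Let $n\ge 2$, $d\ge 1$, $K\ge 1$, $\sigma^2>0$, $\theta\in\Delta_K$, and $\mu_1,\dots,\mu_K\in\mathbb{R}^d$ with $\max_{1\le k,k'\le K}\|\mu_k-\mu_{k'}\|\le C_\mu$. Let $\tilde\Sigma_1,\dots,\tilde\Sigma_K$ be positive semi-definite $d\times d$ matrices with $\|\tilde\Sigma_k\|_2\le C_\Sigma$ for all $k$. Let $(Z_i,X_i)_{i=1}^n$ be i.i.d. draws of the isotropic Gaussian mixture with parameters $\theta$, $(\mu_k)$, $\sigma^2$, and, conditionally on $(Z_i,X_i)_{i=1}^n$, let $\eta_1,\dots,\eta_n$ be independent with $\eta_i\sim\mathcal N\big(0,\sum_{k=1}^K Z_{ik}\tilde\Sigma_k\big)$. Set $Y_i=X_i+\eta_i$ (so that, given $Z_{ik}=1$, $Y_i\sim\mathcal N(\mu_k,\sigma^2 I_d+\tilde\Sigma_k)$), and let $C,\tilde C$ be the $n\times n$ matrices $C_{ij}=\|Y_i-Y_j\|^2$, $\tilde C_{ij}=\|X_i-X_j\|^2$. Define the $n\times n$ matrix $E$ by $E_{ii}=0$ and, for $i\ne j$, $E_{ij}=2\langle X_i-X_j,\eta_i-\eta_j\rangle-2\langle\eta_i,\eta_j\rangle$. Then for every $\varepsilon>0$, \[ \big\|\pi^*_{\varepsilon,Q}(C)-\pi^*_{\varepsilon,Q}(\tilde C)\big\|_F\le\frac1\varepsilon\|E\|_F, \] and each entry of $E$ satisfies $\mathbb E[E_{ij}]=0$ and $\mathbb E[E_{ij}^2]\le c\,d$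 for a constant $c$ depending only on $C_\mu$, $C_\Sigma$ and $\sigma^2$; in particular each entry of $E$ is $O_p(d^{1/2})$.
   Context: Isotropic Gaussian mixture: $\theta\in\Delta_K=\{x\in\mathbb R_+^K:\sum_k x_k=1\}$; $Z_i\in\{0,1\}^K$ has exactly one entry equal to one, drawn from $\mathrm{Mult}(1;\theta_1,\dots,\theta_K)$, and conditionally on $Z_{ik}=1$, $X_i\sim\mathcal N(\mu_k,\sigma^2 I_d)$. $\|A\|_2$ is the largest singular value, $\|\cdot\|_F$ the Frobenius norm, $\langle A,B\rangle=\sum_{ij}A_{ij}B_{ij}$. $B_n^\circ$ denotes the set of $n\times n$ matrices with nonnegative entries, all row sums and column sums equal to $1$, and zero diagonal (''hollow bistochastic matrices''). For a real $n\times n$ matrix $C$ and $\varepsilon>0$, $\pi^*_{\varepsilon,Q}(C)=\arg\min_{\pi\in B_n^\circ}\langle\pi,C\rangle+\frac\varepsilon2\|\pi\|_F^2$ (quadratically regularised hollow self-transport; the minimiser is unique). *)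

(* Defs.v *)
From HB Require Import structures.
From mathcomp Require Import all_boot all_order all_algebra.
From mathcomp Require Import all_classical all_reals all_analysis.
From mathcomp Require Import normal_distribution.

Set Implicit Arguments.
Unset Strict Implicit.
Unset Printing Implicit Defensive.

Import Order.TTheory GRing.Theory Num.Theory.
Local Open Scope classical_set_scope.
Local Open Scope ring_scope.

Section Defs.
Variable R : realType.

Definition dotv (d : nat) (u v : 'rV[R]_d) : R := \sum_(l < d) u 0 l * v 0 l.
Definition normv (d : nat) (u : 'rV[R]_d) : R := Num.sqrt (dotv u u).

Definition qform (d : nat) (v : 'rV[R]_d) (A : 'M[R]_d) : R := (v *m A *m v^T) 0 0.

Definition psd (d : nat) (A : 'M[R]_d) : Prop :=
  A^T = A /\ forall v : 'rV[R]_d, 0 <= qform v A.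

Definition spec_norm (d : nat) (A : 'M[R]_d) : R :=
  sup [set x : R | exists v : 'rV[R]_d, normv v = 1 /\ x = normv (v *m A)].

Definition frob (m n : nat) (A : 'M[R]_(m, n)) : R :=
  Num.sqrt (\sum_(i < m) \sum_(j < n) A i j ^+ 2).
Definition frob_inner (n : nat) (A B : 'M[R]_n) : R :=
  \sum_(i < n) \sum_(j < n) A i j * B i j.

Definition hollow_bistochastic (n : nat) (pi : 'M[R]_n) : Prop :=
  [/\ (forall i j, 0 <= pi i j),
      (forall i, \sum_(j < n) pi i j = 1),
      (forall j, \sum_(i < n) pi i j = 1) &
      (forall i, pi i i = 0)].

Definition qot_obj (n : nat) (eps : R) (C pi : 'M[R]_n) : R :=
  frob_inner pi C + eps / 2 * frob pi ^+ 2.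

Definition is_qot_argmin (n : nat) (eps : R) (C pi : 'M[R]_n) : Prop :=
  hollow_bistochastic pi /\
  forall pi' : 'M[R]_n, hollow_bistochastic pi' -> qot_obj eps C pi <= qot_obj eps C pi'.

Definition pistar (n : nat) (eps : R) (C : 'M[R]_n) : 'M[R]_n :=
  xget 0 [set pi | is_qot_argmin eps C pi].

Definition gauss_law (m v : R) : set R -> \bar R :=
  if v == 0 then @dirac _ R m R else normal_prob m (Num.sqrt v).

(** The joint model:
    - P(Z = z) = prod_i theta_(z_i)  (Z_i i.i.d. Mult(1; theta), Z_i coded by its index),
    - conditionally on Z = z, the vector (X_1,..,X_n,eta_1,..,eta_n) is Gaussian with
      mean (mu_(z_1),..,mu_(z_n),0,..,0) and block-diagonal covariance
      diag(s2 I,..,s2 I, Sig_(z_1),..,Sig_(z_n)); stated (without dividing by P(Z=z))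
      through the laws of all linear functionals (definition of a Gaussian vector). *)
Definition noisy_gmm_model (dT : measure_display) (T : measurableType dT)
  (P : probability T R) (n d K : nat) (theta : 'I_K -> R) (mu : 'I_K -> 'rV[R]_d)
  (s2 : R) (Sig : 'I_K -> 'M[R]_d)
  (Z : 'I_n -> T -> 'I_K) (X eta : 'I_n -> T -> 'rV[R]_d) : Prop :=
  [/\ (forall i k, measurable [set t | Z i t = k]),
      (forall i (l : 'I_d), measurable_fun setT (fun t => X i t 0 l)),
      (forall i (l : 'I_d), measurable_fun setT (fun t => eta i t 0 l)),
      (forall z : 'I_n -> 'I_K,
          P [set t | forall i, Z i t = z i] = (\prod_(i < n) theta (z i))%:E) &
      (forall (z : 'I_n -> 'I_K) (u v : 'I_n -> 'rV[R]_d) (B : set R), measurable B ->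
          P [set t | (forall i, Z i t = z i) /\
                     B (\sum_(i < n) (dotv (u i) (X i t) + dotv (v i) (eta i t)))]
          = ((\prod_(i < n) theta (z i))%:E *
             gauss_law (\sum_(i < n) dotv (u i) (mu (z i)))
                       (\sum_(i < n) (s2 * dotv (u i) (u i) + qform (v i) (Sig (z i)))) B)%E)].

End Defs.

(* Main.v *)
(* Off the diagonal C = Ct + E + (a_i + a_j) with a_i = |eta_i|^2, and the separable
   part is constant on hollow bistochastic matrices. Adding the variational
   inequalities of the two minimisers p (for C) and q (for Ct) therefore gives
   eps |p - q|^2 <= - <p - q, E>, whence the stability bound by Cauchy-Schwarz.

   For the moments, work on each event {Z = z}. The model only prescribes the laws of
   linear functionals, so the mixed moments E[x_k x_l y_k y_l] of two uncorrelated
   Gaussian vectors x, y (y centred) are obtained by polarization from second and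
   fourth moments of linear functionals. Off-diagonal terms of the covariance of x
   drop out, which leaves E[<x, y>^2] = O(d); this is applied to
   (X_i - X_j, eta_i - eta_j) and to (eta_i, eta_j). *)

Require Import Defs.
From HB Require Import structures.
From mathcomp Require Import all_boot all_order all_algebra.
From mathcomp Require Import all_classical all_reals all_analysis.
From mathcomp Require Import random_variable normal_distribution.
From mathcomp Require Import measurable_realfun ring lra.

Import Order.TTheory GRing.Theory Num.Theory.
Local Open Scope classical_set_scope.
Local Open Scope ring_scope.

(** * Stability of quadratically regularised hollow transport *)

Section QuadraticTransport.
Set Implicit Arguments.
Unset Strict Implicit.
Import numFieldNormedType.Exports.
Variable R : realType.

(** Cauchy-Schwarz: the nonnegative sum of squares [(a * g i - c * f i) ^+ 2] equals
    [a * (a * b - c ^+ 2)]. The factor [a] can be cancelled unless [a = 0], and then every [f i]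
    vanishes. *)
Lemma sqr_sum_mul_le (I : finType) (f g : I -> R) :
  (\sum_i f i * g i) ^+ 2 <= (\sum_i f i ^+ 2) * (\sum_i g i ^+ 2).
Proof.
set a := \sum_i f i ^+ 2; set b := \sum_i g i ^+ 2; set c := \sum_i f i * g i.
have a0 : 0 <= a by apply: sumr_ge0 => i _; exact: sqr_ge0.
have : 0 <= \sum_i (a * g i - c * f i) ^+ 2.
  by apply: sumr_ge0 => i _; exact: sqr_ge0.
have -> : \sum_i (a * g i - c * f i) ^+ 2 = a * (a * b - c ^+ 2).
  rewrite (eq_bigr (fun i => a ^+ 2 * g i ^+ 2 + (- (2 * a * c)) * (f i * g i)
    + c ^+ 2 * f i ^+ 2)) => [|i _]; last by ring.
  rewrite !big_split /= -!mulr_sumr -/a -/b -/c; ring.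
move: a0; rewrite le_eqVlt => /predU1P[a0 _|a0]; last by rewrite pmulr_rge0// subr_ge0.
have f0 i : f i = 0.
  apply/eqP; rewrite -sqrf_eq0; apply/eqP.
  by have /esym/psumr_eq0P := a0; apply => // j _; exact: sqr_ge0.
rewrite /c big1 ?expr0n /= -?a0 ?mul0r// => i _; by rewrite f0 mul0r.
Qed.

Variable n : nat.
Implicit Types A B C p : 'M[R]_n.

Lemma frob_innerE A B :
  frob_inner A B = \sum_(ij : 'I_n * 'I_n) A ij.1 ij.2 * B ij.1 ij.2.
Proof. by rewrite /frob_inner pair_bigA. Qed.

Lemma frob_innerC A B : frob_inner A B = frob_inner B A.
Proof. by rewrite !frob_innerE; apply: eq_bigr => ij _; rewrite mulrC. Qed.

Lemma frob_inner_linear a A B C :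
  frob_inner (a *: A + B) C = a * frob_inner A C + frob_inner B C.
Proof.
rewrite !frob_innerE mulr_sumr -big_split /=; apply: eq_bigr => ij _.
by rewrite !mxE mulrDl mulrA.
Qed.

Lemma frob_innerDl A B C : frob_inner (A + B) C = frob_inner A C + frob_inner B C.
Proof. by rewrite -{1}(scale1r A) frob_inner_linear mul1r. Qed.

Lemma frob_innerZl a A B : frob_inner (a *: A) B = a * frob_inner A B.
Proof.
rewrite -[a *: A]addr0 frob_inner_linear (_ : frob_inner 0 B = 0) ?addr0//.
by rewrite frob_innerE big1// => ij _; rewrite mxE mul0r.
Qed.

Lemma frob_innerBl A B C : frob_inner (A - B) C = frob_inner A C - frob_inner B C.
Proof. by rewrite frob_innerDl -scaleN1r frob_innerZl mulN1r. Qed.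

Lemma sqr_frob A : frob A ^+ 2 = frob_inner A A.
Proof.
rewrite /frob sqr_sqrtr; last by do 2 (apply: sumr_ge0 => ? _); exact: sqr_ge0.
by rewrite /frob_inner; do 2 (apply: eq_bigr => ? _).
Qed.

Lemma frob_inner_le A B : `|frob_inner A B| <= frob A * frob B.
Proof.
rewrite -(@ler_pXn2r _ 2) ?nnegrE ?normr_ge0 ?mulr_ge0 ?sqrtr_ge0//.
rewrite real_normK ?num_real// exprMn !sqr_frob !frob_innerE.
under [X in _ <= X * _]eq_bigr do rewrite -expr2.
under [X in _ <= _ * X]eq_bigr do rewrite -expr2.
exact: sqr_sum_mul_le.
Qed.

(** Elementary form of the limit [t -> 0], used to extract a first-order optimality condition. *)
Lemma ge0_of_affine_ge0 (a b : R) : 0 <= b ->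
  (forall t, 0 < t -> t <= 1 -> 0 <= a + t * b) -> 0 <= a.
Proof.
move=> b0 H; rewrite leNgt; apply/negP => a0.
have ba : 0 < b - a by lra.
(* Since [b <= b - a], this choice of [t] gives [t * b <= - a / 2], hence
   [a + t * b <= a / 2 < 0]. *)
have t0 : 0 < - a / (2 * (b - a)) by rewrite divr_gt0//; lra.
have t1 : - a / (2 * (b - a)) <= 1 by rewrite ler_pdivrMr; lra.
have := H _ t0 t1.
have : - a / (2 * (b - a)) * (2 * (b - a)) = - a by rewrite divfK//; lra.
move: t0 t1; set t := (X in 0 < X); nra.
Qed.

Lemma hollow_bistochastic_convex t p q : 0 <= t -> t <= 1 ->
  hollow_bistochastic p -> hollow_bistochastic q ->
  hollow_bistochastic (p + t *: (q - p)).
Proof.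
move=> t0 t1 [p0 pr pc pd] [q0 qr qc qd]; split.
- move=> i j; rewrite !mxE (_ : _ + _ = (1 - t) * p i j + t * q i j); last ring.
  by rewrite addr_ge0// mulr_ge0// subr_ge0.
- move=> i; under eq_bigr do rewrite !mxE.
  by rewrite big_split/= -mulr_sumr big_split/= sumrN pr qr subrr mulr0 addr0.
- move=> j; under eq_bigr do rewrite !mxE.
  by rewrite big_split/= -mulr_sumr big_split/= sumrN pc qc subrr mulr0 addr0.
- by move=> i; rewrite !mxE pd qd; ring.
Qed.

(** The segment from [p] to [q] stays feasible. The increment of the objective along it, divided by
    [t], is affine in [t] with slope [eps / 2] times the squared norm of [q - p]. *)
Lemma qot_argmin_variational (eps : R) C p q : 0 < eps ->
  is_qot_argmin eps C p -> hollow_bistochastic q ->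
  0 <= frob_inner (q - p) C + eps * frob_inner (q - p) p.
Proof.
move=> eps0 [hp pmin] hq.
apply: (@ge0_of_affine_ge0 _ (eps / 2 * frob_inner (q - p) (q - p))).
  by rewrite mulr_ge0 ?divr_ge0 ?(ltW eps0)// -sqr_frob sqr_ge0.
move=> t t0 t1; have := pmin _ (hollow_bistochastic_convex (ltW t0) t1 hp hq).
rewrite /qot_obj !sqr_frob; move: (q - p) => D.
have -> : frob_inner (p + t *: D) (p + t *: D) =
    frob_inner p p + 2 * t * frob_inner D p + t ^+ 2 * frob_inner D D.
  rewrite frob_innerDl frob_innerZl (frob_innerC p) (frob_innerC D (p + _)).
  rewrite !frob_innerDl !frob_innerZl (frob_innerC p D); ring.
rewrite frob_innerDl frob_innerZl.
set x := frob_inner D C; set y := frob_inner D p; set z := frob_inner D D.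
move=> H; rewrite -(pmulr_rge0 _ t0); lra.
Qed.

(** * Existence of the regularised transport plan *)

Lemma uniform_hollow_bistochastic : (2 <= n)%N ->
  hollow_bistochastic (\matrix_(i < n, j < n) (if i == j then 0 else n.-1%:R^-1 : R)).
Proof.
move=> n2; have n1 : (n.-1%:R : R) != 0.
  by rewrite pnatr_eq0 -lt0n -subn1 subn_gt0.
have S (i : 'I_n) : \sum_(j < n | j != i) (n.-1%:R^-1 : R) = 1.
  by rewrite sumr_const cardC1 card_ord -[LHS]mulr_natl mulfV.
split.
- by move=> i j; rewrite mxE; case: ifP => // _; rewrite invr_ge0.
- move=> i; rewrite -[RHS](S i) [RHS]big_mkcond; apply: eq_bigr => j _.
  by rewrite mxE eq_sym; case: eqP.
- move=> i; rewrite -[RHS](S i) [RHS]big_mkcond; apply: eq_bigr => j _.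
  by rewrite mxE; case: eqP.
- by move=> i; rewrite mxE eqxx.
Qed.

Lemma continuous_big_sum (T : topologicalType) (I : finType) (F : I -> T -> R) :
  (forall i, continuous (F i)) -> continuous (fun v => \sum_i F i v).
Proof.
move=> Fc; elim: (index_enum I) => [|i s IH] v.
  by under [fun _ => _]funext do rewrite big_nil; exact: cvg_cst.
by under [fun _ => _]funext do rewrite big_cons; apply: cvgD; [exact: Fc|exact: IH].
Qed.

(** Extreme value theorem on a nonempty closed subset of a cube. Matrices are flattened by [mxvec]
    so that compactness of boxes of row vectors and continuity of coordinates apply. *)
Lemma qot_argmin_exists (eps : R) C : (2 <= n)%N ->
  exists p, is_qot_argmin eps C p.
Proof.
move=> n2.
have ec i j : continuous (fun v : 'rV[R]_(n * n) => vec_mx v i j).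
  under [fun _ => _]funext do rewrite mxE; exact: coord_continuous.
have preim (f : 'rV[R]_(n * n) -> R) (A : set R) :
  continuous f -> closed A -> closed (f @^-1` A).
  by move=> fc Ac; apply: closed_comp => // v _; exact: fc.
pose K := [set v : 'rV[R]_(n * n) | hollow_bistochastic (vec_mx v)].
have clK : closed K.
  rewrite (_ : K = (\bigcap_(ij in [set: 'I_n * 'I_n]) [set v | 0 <= vec_mx v ij.1 ij.2])
    `&` (\bigcap_(i in [set: 'I_n]) [set v | \sum_j vec_mx v i j = 1])
    `&` (\bigcap_(j in [set: 'I_n]) [set v | \sum_i vec_mx v i j = 1])
    `&` (\bigcap_(i in [set: 'I_n]) [set v | vec_mx v i i = 0])); last first.
    apply/seteqP; split => v /=.
      by move=> [h1 h2 h3 h4]; split; [split; [split|]|] => // ? _;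
        [exact: h1|exact: h2|exact: h3|exact: h4].
    move=> [[[h1 h2] h3] h4]; split=> // *;
      [exact: (h1 (_, _))|exact: h2|exact: h3|exact: h4].
  apply: closedI; [apply: closedI; [apply: closedI|]|]; apply: closed_bigI => i _.
  - apply: (preim (fun v => vec_mx v i.1 i.2) [set x | 0 <= x]) => //; exact: closed_ge.
  - apply: (preim (fun v => \sum_j vec_mx v i j) [set x | x = 1]); last exact: closed_eq.
    by apply: continuous_big_sum => j; exact: ec.
  - apply: (preim (fun v => \sum_j vec_mx v j i) [set x | x = 1]); last exact: closed_eq.
    by apply: continuous_big_sum => j; exact: ec.
  - apply: (preim (fun v => vec_mx v i i) [set x | x = 0]) => //; exact: closed_eq.
have cK : compact K.
  have cbox : compact [set v : 'rV[R]_(n * n) | forall k, v ord0 k \in `[0, 1]].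
    apply: (@rV_compact _ _ (fun=> `[(0 : R), 1]%classic)) => _.
    exact: segment_compact.
  apply: (subclosed_compact clK cbox).
  move=> v [h1 h2 _ _] k; case: (mxvec_indexP k) => i j; rewrite /= in_itv /=.
  have := h1 i j; rewrite mxE => -> /=.
  (* An entry is at most its row sum, which is 1. *)
  rewrite -(h2 i) (bigD1 j) //= mxE lerDl; apply: sumr_ge0 => ? _; exact: h1.
(* The uniform hollow plan is feasible; [2 <= n] enters here, making [n.-1] invertible. *)
have K0 : K !=set0.
  exists (mxvec (\matrix_(i < n, j < n) (if i == j then 0 else n.-1%:R^-1 : R))).
  by rewrite /K /= mxvecK; exact: uniform_hollow_bistochastic.
have ic (A : 'rV[R]_(n * n) -> 'M[R]_n) : (forall i j, continuous (fun v => A v i j)) ->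
    continuous (fun v => frob_inner (vec_mx v) (A v)).
  move=> Ac; apply: continuous_big_sum => i; apply: continuous_big_sum => j v.
  exact: (cvgM (ec i j v) (Ac i j v)).
have objc : continuous (fun v : 'rV[R]_(n * n) => qot_obj eps C (vec_mx v)).
  rewrite (_ : (fun v => _) = fun v => frob_inner (vec_mx v) C
    + eps / 2 * frob_inner (vec_mx v) (vec_mx v)); last first.
    by apply/funext => v; rewrite /qot_obj sqr_frob.
  have cC : continuous (fun v : 'rV[R]_(n * n) => frob_inner (vec_mx v) C).
    by apply: (ic (fun=> C)) => i j; exact: cst_continuous.
  move=> v; exact: (cvgD (cC v) (cvgM (cvg_cst _) (ic vec_mx ec v))).
have [|v vK vmin] := @compact_EVT_min _ R (fun v => qot_obj eps C (vec_mx v)) K K0 cK.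
  by apply: continuous_subspaceT; exact: objc.
exists (vec_mx v); split; first by rewrite inE in vK.
move=> p hp; rewrite -(mxvecK p); apply: vmin; rewrite inE /K /= mxvecK //.
Qed.

(** Existence rules out the default value [0] of [xget]. *)
Lemma pistarP (eps : R) C : (2 <= n)%N -> is_qot_argmin eps C (pistar eps C).
Proof.
move=> n2; have [p pP] := qot_argmin_exists eps C n2.
exact: (@xgetPex _ _ [set p | is_qot_argmin eps C p]) (ex_intro _ p pP).
Qed.

(* On hollow bistochastic matrices, adding [a i + a j] to the off-diagonal costs
   shifts the objective by a constant. *)
Lemma frob_inner_separable (a : 'I_n -> R) B p q :
  hollow_bistochastic p -> hollow_bistochastic q ->
  (forall i j, i != j -> B i j = a i + a j) -> frob_inner (q - p) B = 0.
Proof.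
move=> [_ pr pc pd] [_ qr qc qd] Ba.
transitivity (\sum_i \sum_j (q - p) i j * (a i + a j)).
  apply: eq_bigr => i _; apply: eq_bigr => j _.
  by have [->|/Ba->//] := eqVneq i j; rewrite !mxE pd qd subrr !mul0r.
under eq_bigr do under eq_bigr do rewrite mulrDr !mxE.
under eq_bigr do rewrite big_split/= -mulr_suml big_split/= sumrN pr qr subrr mul0r add0r.
rewrite exchange_big /= big1// => j _.
by rewrite -mulr_suml big_split/= sumrN pc qc subrr mul0r.
Qed.

Lemma frob_pistar_le (eps : R) (C Ct E : 'M[R]_n) (a : 'I_n -> R) : (2 <= n)%N -> 0 < eps ->
  (forall i j, i != j -> C i j = Ct i j + E i j + (a i + a j)) ->
  frob (pistar eps C - pistar eps Ct) <= frob E / eps.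
Proof.
move=> n2 eps0 CE.
have [hp pm] := pistarP eps C n2; have [hq qm] := pistarP eps Ct n2.
(* Each minimiser is tested against the other one. *)
have := qot_argmin_variational eps0 (conj hp pm) hq.
have := qot_argmin_variational eps0 (conj hq qm) hp.
set p := pistar eps C in hp pm *; set q := pistar eps Ct in hq qm *.
have : frob_inner (p - q) (C - Ct - E) = 0.
  apply: (frob_inner_separable (a := a) hq hp) => i j ij.
  by rewrite !mxE CE//; ring.
have : frob_inner (p - q) p - frob_inner (p - q) q = frob (p - q) ^+ 2.
  by rewrite sqr_frob (frob_innerBl p q (p - q)) !(frob_innerC _ (p - q)).
rewrite -(opprB p q) -[- (p - q)]scaleN1r !frob_innerZl.
move: (p - q) => D nD; rewrite (frob_innerC D) !frob_innerBl !(frob_innerC _ D) => sep h1 h2.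
rewrite ler_pdivlMr//.
(* The zero case is separate because one factor [frob D] is cancelled below. *)
have [->|D0] := eqVneq (frob D) 0; first by rewrite mul0r sqrtr_ge0.
have {}D0 : 0 < frob D by rewrite lt_def D0 sqrtr_ge0.
rewrite -(ler_pM2l D0) (le_trans _ (frob_inner_le _ _))//.
(* The right disjunct bounds [eps * frob D ^+ 2] by minus the pairing of [D] with [E]: the sum of
   [h1] and [h2], with [sep] removing the separable part. *)
rewrite mulrA -expr2 -nD ler_normr; apply/orP; right; lra.
Qed.

End QuadraticTransport.
(** * Moments of Gaussian laws *)

Section GaussianMixture.
Set Implicit Arguments.
Unset Strict Implicit.
Import numFieldNormedType.Exports.
Variable R : realType.
Notation lambda := (@lebesgue_measure R).

(** * Integration against a density *)

Section Density.
Import HBNNSimple.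
Local Open Scope ereal_scope.
Context d (T : measurableType d).
Variables (mu nu : {measure set T -> \bar R}) (g : T -> R).
Hypotheses (mg : measurable_fun setT g) (g0 : forall x, (0 <= g x)%R).
Hypothesis nuE : forall A, measurable A -> nu A = \int[mu]_(x in A) (g x)%:E.

Let integral_density_nnsfun (h : {nnsfun T >-> R}) :
  \int[nu]_x (h x)%:E = \int[mu]_x ((h x)%:E * (g x)%:E).
Proof.
under [LHS]eq_integral do rewrite fimfunE -fsumEFin//.
rewrite [LHS]ge0_integral_fsum//; last 2 first.
  - by move=> r; exact/measurable_EFinP/measurableT_comp.
  - by move=> n x _; rewrite EFinM nnfun_muleindic_ge0.
under [RHS]eq_integral.
  move=> x xD; rewrite fimfunE -fsumEFin// muleC ge0_mule_fsumr; last first.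
    by move=> r; rewrite EFinM nnfun_muleindic_ge0.
  over.
rewrite [RHS]ge0_integral_fsum//; last 2 first.
  - move=> r; apply/emeasurable_funM; apply/measurable_EFinP => //.
    exact/measurableT_comp.
  - by move=> r x _; rewrite mule_ge0 // ?EFinM ?nnfun_muleindic_ge0 // lee_fin.
(* A nonnegative simple function has empty fibres over negative [r], so both terms vanish. *)
apply: eq_fsbigr => r _; have [r0|r0] := leP 0%R r; last first.
  rewrite preimage_nnfun0// indic0 !integral0_eq// => x _.
    by rewrite mulr0 mule0.
  by rewrite mulr0.
under [RHS]eq_integral do rewrite EFinM muleCA.
rewrite integralZl_indic_nnsfun// ge0_integralZl//; last 2 first.
- by apply: emeasurable_funM; exact/measurable_EFinP.
- by move=> x _; rewrite mule_ge0 ?lee_fin.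
congr (_ * _); rewrite integral_indic// setIT nuE//.
rewrite integral_mkcond; apply: eq_integral => x _.
by rewrite patchE indicE; case: ifP => _; rewrite ?mule1 ?mule0.
Qed.

(** Monotone convergence along [nnsfun_approx] extends the identity from simple functions. *)
Lemma ge0_integral_density (f : T -> \bar R) :
  measurable_fun setT f -> (forall x, 0 <= f x) ->
  \int[nu]_x f x = \int[mu]_x (f x * (g x)%:E).
Proof.
move=> mf f0; pose f_ := nnsfun_approx measurableT mf.
have cf x : (f_ n x)%:E @[n --> \oo] --> f x.
  exact: cvg_nnsfun_approx.
transitivity (limn (fun n => \int[nu]_x (f_ n x)%:E)).
  rewrite -monotone_convergence//=.
  - by apply: eq_integral => x _; apply/esym/cvg_lim.
  - by move=> n; apply: measurableT_comp => //; exact: measurable_funTS.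
  - by move=> n x _; rewrite lee_fin.
  - by move=> x _ a b ab; rewrite lee_fin//; exact/lefP/nd_nnsfun_approx.
under eq_fun do rewrite integral_density_nnsfun.
rewrite -monotone_convergence//=.
- apply: eq_integral => x _; apply/cvg_lim => //.
  by apply: cvgeZr => //; exact: cf.
- by move=> n; apply: emeasurable_funM; exact/measurable_EFinP.
- by move=> n x _; rewrite mule_ge0 ?lee_fin.
- move=> x _ a b ab; rewrite lee_wpmul2r ?lee_fin//; exact/lefP/nd_nnsfun_approx.
Qed.
End Density.

(** Folding the line at the origin turns the integral of [F] into that of [F x + F (- x)] over the
    half line, so only the even part matters. Nonnegativity lets this hold even for infinite
    integrals. *)
Lemma ge0_integralT_reflect (G H : R -> R) :
  continuous G -> continuous H -> (forall x, 0 <= G x) -> (forall x, 0 <= H x) ->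
  (forall x, G x + G (- x) = H x + H (- x)) ->
  (\int[lambda]_x (G x)%:E = \int[lambda]_x (H x)%:E)%E.
Proof.
have fold (F : R -> R) : continuous F -> (forall x, 0 <= F x) ->
    (\int[lambda]_x (F x)%:E =
     \int[lambda]_(x in `[0%R, +oo[) (F x + F (- x))%:E)%E.
  move=> Fc F0.
  have mF : measurable_fun setT F by exact: continuous_measurable_fun.
  have mFN : measurable_fun setT (fun x : R => F (- x)).
    by apply: measurableT_comp => //; exact: oppr_measurable.
  under [RHS]eq_integral do rewrite EFinD.
  rewrite ge0_integralD//; last 4 first.
  - by move=> x _; rewrite lee_fin.
  - exact/measurable_EFinP/measurable_funTS.
  - by move=> x _; rewrite lee_fin.
  - exact/measurable_EFinP/measurable_funTS.
  rewrite -(setUv `[0%R, +oo[%classic) ge0_integral_setU//=; last 4 first.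
  - exact: measurableC.
  - by apply/measurable_EFinP; rewrite setUv.
  - by move=> x _; rewrite lee_fin.
  - exact/disj_setPCl.
  congr (_ + _)%E; rewrite setCitvr.
  (* The point 0 is negligible, so the open left half line may be closed before substituting
     [- x]. *)
  rewrite integral_itv_bndo_bndc; last exact/measurable_EFinP/measurable_funTS.
  rewrite -{1}oppr0 ge0_integration_by_substitutionNy//.
  exact: continuous_subspaceT.
move=> Gc Hc G0 H0 GH; rewrite !fold//.
by apply: eq_integral => x _; rewrite GH.
Qed.
(* The values 1 and 3 of the moments of orders 2 and 4 are never needed: only their
   finiteness, and the vanishing of odd moments via the reflection x |-> -x. *)
Definition std_moment k : R := fine (\int[lambda]_x (x ^+ k * normal_pdf 0 1 x)%:E).

(** Domination by two integrable Gaussians: $x^k e^{-x^2/2} \le e^{-x^2/2} + 16 e^{-x^2/8}$ for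
    these [k]. *)
Lemma std_moment_fin k : k = 2%N \/ k = 4%N ->
  (\int[lambda]_x (x ^+ k * normal_pdf 0 1 x)%:E)%E = (std_moment k)%:E.
Proof.
move=> k24; rewrite /std_moment fineK//.
pose c : R := 16 * (normal_peak 1 / normal_peak 2).
have p1 := @normal_peak_gt0 R 1 (oner_neq0 _).
have p2 := @normal_peak_gt0 R 2 (lt0r_neq0 (ltr0n _ 2)).
(* The constant [c] combines the factor 16 with the ratio that converts the normalisation of
   [normal_pdf 0 2] into that of [normal_pdf 0 1]. *)
have x0 (x : R) : 0 <= x ^+ k by case: k24 => ->; rewrite exprn_even_ge0.
have mk : measurable_fun setT (fun x : R => x ^+ k * normal_pdf 0 1 x).
  by apply: measurable_funM; [exact: measurable_funX|exact: measurable_normal_pdf].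
have mn : measurable_fun setT (fun x : R => normal_pdf 0 2 x).
  exact: measurable_normal_pdf.
have mn1 : measurable_fun setT (fun x : R => normal_pdf 0 1 x).
  exact: measurable_normal_pdf.
rewrite ge0_fin_numE; last first.
  by apply: integral_ge0 => x _; rewrite lee_fin mulr_ge0// normal_pdf_ge0.
apply: (@le_lt_trans _ _ (\int[lambda]_x (normal_pdf 0 1 x + c * normal_pdf 0 2 x)%:E)%E).
  apply: ge0_le_integral => //.
  - by move=> x _; rewrite lee_fin mulr_ge0// normal_pdf_ge0.
  - exact/measurable_EFinP.
  - apply/measurable_EFinP; apply: measurable_funD => //.
    by apply: measurable_funM => //; exact: measurable_cst.
  move=> x _; rewrite lee_fin.
  rewrite !normal_pdfE ?oner_neq0 ?pnatr_eq0// /normal_fun !subr0.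
  set a := expR _; set b := expR _.
  have a0 : 0 < a by exact: expR_gt0.
  have -> : b = a * expR (3 / 8 * x ^+ 2).
    by rewrite /a /b -expRD; congr expR; field.
  have y0 : 0 <= 3 / 8 * x ^+ 2 by rewrite mulr_ge0 ?sqr_ge0.
  (* A quadratic lower bound of the exponential at $3x^2/8$ suffices to dominate $x^4$. *)
  have := expR_ge1Dxn 1 y0; set y := expR _ => yge.
  rewrite [leRHS](_ : _ = normal_peak 1 * a + normal_peak 1 * a * (16 * y)); last first.
    by congr (_ + _); rewrite /c; field; rewrite gt_eqF.
  rewrite mulrC -[X in X + _]mulr1 -mulrDr ler_wpM2l ?mulr_ge0 ?(ltW p1) ?(ltW a0)//.
  have x2 := sqr_ge0 x.
  have x4 : x ^+ 4 = (x ^+ 2) ^+ 2 by rewrite -exprM.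
  rewrite !factS fact0 !muln1 in yge; case: k24 => ->; rewrite ?x4; nra.
under eq_integral do rewrite EFinD EFinM.
rewrite ge0_integralD//; last 4 first.
- by move=> x _; rewrite lee_fin normal_pdf_ge0.
- exact/measurable_EFinP.
- move=> x _; rewrite lee_fin mulr_ge0 ?normal_pdf_ge0//.
  by rewrite mulr_ge0// divr_ge0// ltW.
- by apply/measurable_EFinP; apply: measurable_funM => //; exact: measurable_cst.
rewrite ge0_integralZl//; last 3 first.
- exact/measurable_EFinP.
- by move=> x _; rewrite lee_fin normal_pdf_ge0.
- by rewrite lee_fin mulr_ge0// divr_ge0// ltW.
by rewrite !integral_normal_pdf mule1 -EFinD ltry.
Qed.

Lemma std_moment_ge0 k : k = 2%N \/ k = 4%N -> 0 <= std_moment k.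
Proof.
move=> k24; apply: fine_ge0; apply: integral_ge0 => x _.
by rewrite lee_fin mulr_ge0 ?normal_pdf_ge0//; case: k24 => ->; rewrite exprn_even_ge0.
Qed.

(** Standardisation by the substitution [m + s * x]. Even [k] keeps the integrand nonnegative, as
    the density and substitution lemmas require. *)
Lemma integral_normal_prob_even (m s : R) k : 0 < s -> ~~ odd k ->
  (\int[normal_prob m s]_x (x ^+ k)%:E =
   \int[lambda]_x ((m + s * x) ^+ k * normal_pdf 0 1 x)%:E)%E.
Proof.
move=> s0 k_even; have s_neq0 := lt0r_neq0 s0.
rewrite (@ge0_integral_density _ _ lambda (normal_prob m s) _ (measurable_normal_pdf m s)
  (normal_pdf_ge0 m s) (fun _ _ => erefl)); last 2 first.
- by apply/measurable_EFinP; exact: measurable_funX.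
- by move=> x; rewrite lee_fin exprn_even_ge0.
(* A shift followed by a positive scaling: in this form the limits at both infinities are
   immediate. *)
pose F (x : R^o) := (x + m / s) * s.
have FE x : F x = m + s * x by rewrite /F mulrDl divfK// addrC mulrC.
have F' : F^`()%classic = cst s.
  apply/funext => x; rewrite /F derive1E deriveM// deriveD// derive_cst scaler0.
  by rewrite add0r derive_id derive_cst addr0 scaler1.
pose G (x : R) := x ^+ k * normal_pdf m s x.
transitivity (\int[lambda]_x (G x)%:E)%E.
  by apply: eq_integral => x _; rewrite EFinM.
rewrite (@increasing_ge0_integration_by_substitutionT _ F G) //.
- apply: eq_integral => x _; rewrite F'.
  have -> : ((G \o F) * cst s) x = G (F x) * s by [].
  rewrite FE /G -mulrA; congr (_ * _)%:E.
  rewrite !normal_pdfE ?oner_neq0// /normal_fun.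
  rewrite (_ : - (m + s * x - m) ^+ 2 / (s ^+ 2 *+ 2) = - (x - 0) ^+ 2 / (1 ^+ 2 *+ 2));
    last by field.
  rewrite mulrAC; congr (_ * _).
  rewrite /normal_peak expr1n mul1r -mulrnAr sqrtrM ?sqr_ge0//.
  by rewrite sqrtr_sqr gtr0_norm// invfM mulrAC mulVf// mul1r.
- by move=> x y xy; rewrite !FE ltrD2l ltr_pM2l.
- by rewrite F' => x; exact: cvg_cst.
- by rewrite F'; exact: is_cvg_cst.
- by rewrite F'; exact: is_cvg_cst.
- by apply/gt0_cvgMlNy; [exact: s0|exact: cvg_addrr_Ny].
- by apply/gt0_cvgMly; [exact: s0|exact: cvg_addrr].
- move=> x; apply: cvgM; first exact: exprn_continuous.
  exact: continuous_normal_pdf.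
- by move=> x; rewrite /G mulr_ge0 ?normal_pdf_ge0// exprn_even_ge0.
Qed.

Lemma integral_even_quartic (a b c : R) : 0 <= a -> 0 <= b -> 0 <= c ->
  (\int[lambda]_x ((a + b * x ^+ 2 + c * x ^+ 4) * normal_pdf 0 1 x)%:E =
   (a + b * std_moment 2 + c * std_moment 4)%:E)%E.
Proof.
move=> a0 b0 c0.
have p0 (x : R) : 0 <= normal_pdf 0 1 x := normal_pdf_ge0 0 1 x.
have mk k : measurable_fun setT (fun x : R => (x ^+ k * normal_pdf 0 1 x)%:E).
  apply/measurable_EFinP/measurable_funM; first exact: measurable_funX.
  exact: measurable_normal_pdf.
have m0 : measurable_fun setT (fun x : R => (normal_pdf 0 1 x)%:E).
  by apply/measurable_EFinP; exact: measurable_normal_pdf.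
have q0 k (x : R) : ~~ odd k -> 0 <= x ^+ k * normal_pdf 0 1 x.
  by move=> ko; rewrite mulr_ge0// exprn_even_ge0.
transitivity (\int[lambda]_x (a%:E * (normal_pdf 0 1 x)%:E +
    (b%:E * (x ^+ 2 * normal_pdf 0 1 x)%:E +
     c%:E * (x ^+ 4 * normal_pdf 0 1 x)%:E)))%E.
  apply: eq_integral => x _; rewrite -!EFinM -!EFinD; congr EFin; ring.
have f0 (e : R) (h : R -> R) x : 0 <= e -> (forall x, 0 <= h x) ->
  (0 <= e%:E * (h x)%:E)%E by move=> e0 h0; rewrite lee_fin mulr_ge0.
have q2 x := q0 2%N x isT; have q4 x := q0 4%N x isT.
rewrite ge0_integralD//; last 4 first.
- by move=> x _; exact: f0.
- by apply: measurable_funeM; first [exact: m0 | exact: mk].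
- by move=> x _; rewrite adde_ge0 // -EFinM lee_fin mulr_ge0.
- by apply: emeasurable_funD; apply: measurable_funeM; exact: mk.
rewrite ge0_integralD//; last 4 first.
- by move=> x _; exact: (f0 _ (fun x => x ^+ 2 * normal_pdf 0 1 x)).
- by apply: measurable_funeM; first [exact: m0 | exact: mk].
- by move=> x _; exact: (f0 _ (fun x => x ^+ 4 * normal_pdf 0 1 x)).
- by apply: measurable_funeM; first [exact: m0 | exact: mk].
rewrite !ge0_integralZl ?lee_fin//; try exact: mk; try by move=> x _; rewrite lee_fin.
rewrite integral_normal_pdf std_moment_fin; last by left.
rewrite std_moment_fin; last by right.
by rewrite mule1 -!EFinM -!EFinD addrA.
Qed.

(** The last hypothesis identifies the even part of [(m + s * x) ^+ k]. The density being even,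
    reflection replaces the power by that even part. *)
Lemma ge0_integral_affine_normal (m s a b c : R) k : ~~ odd k ->
  0 <= a -> 0 <= b -> 0 <= c ->
  (forall x, (m + s * x) ^+ k + (m + s * - x) ^+ k =
             2 * (a + b * x ^+ 2 + c * x ^+ 4)) ->
  (\int[lambda]_x ((m + s * x) ^+ k * normal_pdf 0 1 x)%:E =
   (a + b * std_moment 2 + c * std_moment 4)%:E)%E.
Proof.
move=> k_even a0 b0 c0 E; rewrite -integral_even_quartic//.
have p0 (x : R) : 0 <= normal_pdf 0 1 x := normal_pdf_ge0 0 1 x.
have pc : continuous (normal_pdf 0 1 : R -> R).
  by apply: continuous_normal_pdf; exact: oner_neq0.
have pN (x : R) : normal_pdf 0 1 (- x) = normal_pdf 0 1 x.
  by rewrite normal_pdfE ?oner_neq0// /normal_fun !subr0 sqrrN.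
have xc k' : continuous (fun x : R => x ^+ k') by exact: exprn_continuous.
have sc (e : R) (h : R -> R) : continuous h -> continuous (fun x => e * h x).
  by move=> hc x; exact: (cvgM (cvg_cst e) (hc x)).
have ac (e : R) (h : R -> R) : continuous h -> continuous (fun x => e + h x).
  by move=> hc x; exact: (cvgD (cvg_cst e) (hc x)).
have lc : continuous (fun x : R => m + s * x) := ac m _ (sc s _ (fun y => cvg_id)).
have hc : continuous (fun x : R => a + b * x ^+ 2 + c * x ^+ 4).
  move=> x; apply: (cvgD (ac a _ (sc b _ (xc 2%N)) x)); exact: (sc c _ (xc 4%N)).
apply: ge0_integralT_reflect => [x|x|x|x|x].
- exact: (cvgM (continuous_comp (lc x) (xc k _)) (pc x)).
- exact: (cvgM (hc x) (pc x)).
- by rewrite mulr_ge0// exprn_even_ge0.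
- by rewrite mulr_ge0// !addr_ge0// mulr_ge0// exprn_even_ge0.
- rewrite pN -mulrDl E mulrDr mulrA; ring.
Qed.

Lemma integral_normal_prob_sqr (m s : R) : 0 < s ->
  (\int[normal_prob m s]_x (x ^+ 2)%:E = (m ^+ 2 + std_moment 2 * s ^+ 2)%:E)%E.
Proof.
move=> s0; rewrite integral_normal_prob_even//.
rewrite (@ge0_integral_affine_normal _ _ (m ^+ 2) (s ^+ 2) 0) ?sqr_ge0//.
  by congr EFin; ring.
by move=> x; ring.
Qed.

Lemma integral_normal_prob_pow4 (m s : R) : 0 < s ->
  (\int[normal_prob m s]_x (x ^+ 4)%:E =
   (m ^+ 4 + 6 * std_moment 2 * m ^+ 2 * s ^+ 2 + std_moment 4 * s ^+ 4)%:E)%E.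
Proof.
move=> s0; rewrite integral_normal_prob_even//.
rewrite (@ge0_integral_affine_normal _ _ (m ^+ 4) (6 * m ^+ 2 * s ^+ 2) (s ^+ 4))
  ?exprn_even_ge0//.
- by congr EFin; ring.
- by rewrite -mulrA mulr_ge0// mulr_ge0// sqr_ge0.
- by move=> x; ring.
Qed.

(** Second and, below, fourth moment of N(m, v) with symbolic standard moments. Being polynomial in
    [v], both formulas also cover the Dirac case [v = 0]. *)
Definition gauss_sqr (m v : R) := m ^+ 2 + std_moment 2 * v.
Definition gauss_pow4 (m v : R) :=
  m ^+ 4 + 6 * std_moment 2 * m ^+ 2 * v + std_moment 4 * v ^+ 2.

(* [normal_prob] is a measure on [measurableTypeR R], whose measurable structure does
   not unify with the canonical one of [R]. *)
Lemma integral_scaled_gauss_law (nu : {measure set (measurableTypeR R) -> \bar R})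
    (w m v : R) :
  0 <= w -> 0 <= v ->
  (forall B, measurable B -> nu B = (w%:E * gauss_law m v B)%E) ->
  (\int[nu]_x (x ^+ 2)%:E = (w * gauss_sqr m v)%:E)%E /\
  (\int[nu]_x (x ^+ 4)%:E = (w * gauss_pow4 m v)%:E)%E.
Proof.
move=> w0 v0 nuE.
have mX k : measurable_fun setT (fun x : measurableTypeR R => (x ^+ k)%:E).
  by apply/measurable_EFinP; exact: measurable_funX.
have X0 k (x : R) : ~~ odd k -> setT x -> (0 <= (x ^+ k)%:E)%E.
  by move=> *; rewrite lee_fin exprn_even_ge0.
have nuI (f : measurableTypeR R -> \bar R) (m2 : {measure set (measurableTypeR R) -> \bar R}) :
    measurable_fun setT f -> (forall x, setT x -> 0 <= f x)%E ->
    (forall B, gauss_law m v B = m2 B) ->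
    (\int[nu]_x f x = w%:E * \int[m2]_x f x)%E.
  move=> mf f0 gE; pose k := NngNum w0.
  rewrite (@eq_measure_integral _ _ _ _ (mscale k m2)).
    by rewrite ge0_integral_mscale.
  by move=> B mB _; rewrite nuE// gE.
move: v0; rewrite le_eqVlt => /predU1P[v0|v0].
  have gE B : gauss_law m v B = @dirac _ (measurableTypeR R) m R B.
    by rewrite /gauss_law -v0 eqxx.
  rewrite (nuI _ _ (mX 2%N) (X0 2%N ^~ isT) gE) (nuI _ _ (mX 4%N) (X0 4%N ^~ isT) gE).
  rewrite !integral_dirac//; try exact: mX.
  rewrite !diracT !mul1e -!EFinM /gauss_sqr /gauss_pow4 -v0.
  by split; congr EFin; ring.
have gE B : gauss_law m v B = normal_prob m (Num.sqrt v) B.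
  by rewrite /gauss_law gt_eqF.
rewrite (nuI _ (normal_prob m (Num.sqrt v)) (mX 2%N) (X0 2%N ^~ isT) gE)
  (nuI _ (normal_prob m (Num.sqrt v)) (mX 4%N) (X0 4%N ^~ isT) gE).
rewrite integral_normal_prob_sqr ?sqrtr_gt0// integral_normal_prob_pow4 ?sqrtr_gt0//.
have s2 : Num.sqrt v ^+ 2 = v by rewrite sqr_sqrtr// ltW.
rewrite -!EFinM (_ : Num.sqrt v ^+ 4 = v ^+ 2); last by rewrite -[in RHS]s2 -exprM.
by rewrite s2.
Qed.

(** * Moments of a functional restricted to an event *)

Section RestrictedLaw.
Context d (T : measurableType d) (P : probability T R).
Variables (D : set T) (L : T -> R) (w m v : R).
Hypotheses (mD : measurable D) (mL : measurable_fun setT L).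
Hypotheses (w0 : 0 <= w) (v0 : 0 <= v).
Hypothesis lawE : forall B, measurable B ->
  P [set t | D t /\ B (L t)] = (w%:E * gauss_law m v B)%E.

(** By [lawE], the image under [L] of [P] restricted to [D] is [w] times a Gaussian law, and
    integrals transfer to that image measure. *)
Lemma integral_restricted_gauss :
  (\int[P]_(t in D) (L t ^+ 2)%:E = (w * gauss_sqr m v)%:E)%E /\
  (\int[P]_(t in D) (L t ^+ 4)%:E = (w * gauss_pow4 m v)%:E)%E.
Proof.
pose PD : {measure set T -> \bar R} := mrestr P mD.
have mL' : measurable_fun setT (L : T -> measurableTypeR R) by exact: mL.
pose nu0 : {measure set (measurableTypeR R) -> \bar R} :=
  pushforward PD (L : T -> measurableTypeR R).
pose nu := nu0 mL'.
have nuE B : measurable B -> nu B = (w%:E * gauss_law m v B)%E.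
  move=> mB; rewrite -lawE// /nu /nu0 /= /pushforward /PD /mrestr setIC.
  by congr (P _).
have [<- <-] := integral_scaled_gauss_law w0 v0 nuE.
have key k : ~~ odd k ->
    (\int[P]_(t in D) (L t ^+ k)%:E = \int[nu]_x (x ^+ k)%:E)%E.
  move=> k_even.
  have mLk : measurable_fun setT (fun t => (L t ^+ k)%:E).
    by apply/measurable_EFinP; exact: measurable_funX.
  rewrite ge0_integral_pushforward//; last 2 first.
  - by apply/measurable_EFinP; exact: measurable_funX.
  - by move=> x _; rewrite lee_fin exprn_even_ge0.
  rewrite preimage_setT -[in RHS](setUv D) ge0_integral_setU//=; last 4 first.
  - exact: measurableC.
  - by rewrite setUv.
  - by move=> x _; rewrite lee_fin exprn_even_ge0.
  - exact/disj_setPCl.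
  (* The restricted measure gives no mass to the complement of [D]. *)
  rewrite [X in (_ + X)%E](_ : _ = 0%E) ?adde0.
    by apply: eq_measure_integral => A mA AD; rewrite /PD /= /mrestr setIidl.
  apply: null_set_integral => //; first exact: measurableC.
    exact: measurable_funTS.
  by rewrite /PD /= /mrestr setICl measure0.
by split; exact: key.
Qed.

End RestrictedLaw.

(** * Mixed moments of Gaussian functionals by polarization *)

(** Integrability and value are bundled so that linear combinations need no side conditions. *)
Definition has_integral d (T : measurableType d) (mu : {measure set T -> \bar R})
    (D : set T) (f : T -> R) (r : R) :=
  mu.-integrable D (EFin \o f) /\ (\int[mu]_(t in D) (f t)%:E)%E = r%:E.

Section HasIntegral.
Context d (T : measurableType d) (mu : {measure set T -> \bar R}).
Variables (D : set T) (mD : measurable D).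
Implicit Types (f g : T -> R) (r s : R).

Lemma ge0_has_integral f r : measurable_fun D f -> (forall t, 0 <= f t) ->
  (\int[mu]_(t in D) (f t)%:E)%E = r%:E -> has_integral mu D f r.
Proof.
move=> mf f0 fr; split=> //; apply/integrableP; split; first exact/measurable_EFinP.
under eq_integral do rewrite /= ger0_norm//.
by rewrite fr ltry.
Qed.

Lemma has_integral_ext f g r s : f =1 g -> r = s ->
  has_integral mu D f r -> has_integral mu D g s.
Proof. by move=> /funext -> ->. Qed.

Lemma has_integralD f g r s : has_integral mu D f r -> has_integral mu D g s ->
  has_integral mu D (fun t => f t + g t) (r + s).
Proof.
move=> [fi fr] [gi gs]; split.
  by rewrite (_ : _ \o _ = (EFin \o f) \+ (EFin \o g))%E//; exact: integrableD.
by under eq_integral do rewrite EFinD; rewrite integralD// fr gs.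
Qed.

Lemma has_integralZ a f r : has_integral mu D f r ->
  has_integral mu D (fun t => a * f t) (a * r).
Proof.
move=> [fi fr]; split.
  rewrite (_ : _ \o _ = (fun t => a%:E * (EFin \o f) t))%E//; exact: integrableZl.
by under eq_integral do rewrite EFinM; rewrite integralZl// fr.
Qed.

Lemma has_integral_sum (I : finType) (f : I -> T -> R) (r : I -> R) :
  (forall i, has_integral mu D (f i) (r i)) ->
  has_integral mu D (fun t => \sum_i f i t) (\sum_i r i).
Proof.
move=> fr; elim: (index_enum I) => [|i s IH].
  apply: (@has_integral_ext (cst 0) _ 0); [by move=> t; rewrite big_nil|by rewrite big_nil|].
  by split; [exact: integrable0|exact: integral0].
apply: (has_integral_ext _ _ (has_integralD (fr i) IH)); first by move=> t; rewrite big_cons.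
by rewrite big_cons.
Qed.

End HasIntegral.

Section Polarization.
Context d (T : measurableType d) (mu : {measure set T -> \bar R}).
Variables (D : set T) (mD : measurable D) (w : R).

Implicit Types (A B f : T -> R) (a b m v : R).

(** The only trace of Gaussianity used from here on; [w] plays the part of the probability of
    [D]. *)
Definition gaussian_moments f m v :=
  has_integral mu D (fun t => f t ^+ 2) (w * gauss_sqr m v) /\
  has_integral mu D (fun t => f t ^+ 4) (w * gauss_pow4 m v).

Lemma gaussian_moments_ext f g m m' v v' : f =1 g -> m = m' -> v = v' ->
  gaussian_moments f m v -> gaussian_moments g m' v'.
Proof. by move=> /funext -> -> ->. Qed.

(** Equal second moments of [A + B] and [A - B] make the product integrate to zero. In the
    fourth-order identity the terms in [m ^+ 4], [a ^+ 2] and [b ^+ 2] cancel, leaving a value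
    linear in [b]. *)
Lemma has_integral_uncorrelated A B m a b :
  gaussian_moments A m a -> gaussian_moments B 0 b ->
  gaussian_moments (fun t => A t + B t) m (a + b) ->
  gaussian_moments (fun t => A t - B t) m (a + b) ->
  has_integral mu D (fun t => A t * B t) 0 /\
  has_integral mu D (fun t => A t ^+ 2 * B t ^+ 2)
    (w * (std_moment 2 * m ^+ 2 + std_moment 4 / 3 * a) * b).
Proof.
move=> [_ A4] [_ B4] [AB2 AB4] [AC2 AC4]; split.
  apply: (has_integral_ext _ _ (has_integralD mD (has_integralZ mD (4^-1) AB2)
    (has_integralZ mD (- 4^-1) AC2))); first by move=> t; field.
  by ring.
(* 12 A^2 B^2 = (A + B)^4 + (A - B)^4 - 2 A^4 - 2 B^4 *)
apply: (has_integral_ext _ _ (has_integralD mD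
  (has_integralD mD (has_integralZ mD (12^-1) AB4) (has_integralZ mD (12^-1) AC4))
  (has_integralD mD (has_integralZ mD (- 6^-1) A4) (has_integralZ mD (- 6^-1) B4)))).
  by move=> t; field.
by rewrite /gauss_pow4; field.
Qed.

End Polarization.

(** * Inner products and quadratic forms *)

Lemma dotvC n (u v : 'rV[R]_n) : dotv u v = dotv v u.
Proof. by apply: eq_bigr => l _; rewrite mulrC. Qed.

Lemma dotvDl n (u u' v : 'rV[R]_n) : dotv (u + u') v = dotv u v + dotv u' v.
Proof. by rewrite /dotv -big_split; apply: eq_bigr => l _; rewrite mxE mulrDl. Qed.

Lemma dotvZl n a (u v : 'rV[R]_n) : dotv (a *: u) v = a * dotv u v.
Proof. by rewrite /dotv mulr_sumr; apply: eq_bigr => l _; rewrite mxE mulrA. Qed.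

Lemma dotvNl n (u v : 'rV[R]_n) : dotv (- u) v = - dotv u v.
Proof. by rewrite -scaleN1r dotvZl mulN1r. Qed.

Lemma dotvDr n (u v v' : 'rV[R]_n) : dotv u (v + v') = dotv u v + dotv u v'.
Proof. by rewrite !(dotvC u) dotvDl. Qed.

Lemma dotvNr n (u v : 'rV[R]_n) : dotv u (- v) = - dotv u v.
Proof. by rewrite !(dotvC u) dotvNl. Qed.

Lemma dotv0l n (v : 'rV[R]_n) : dotv 0 v = 0.
Proof. by rewrite -(scale0r 0) dotvZl mul0r. Qed.

Lemma dotv_delta n (l : 'I_n) (v : 'rV[R]_n) : dotv (delta_mx 0 l) v = v 0 l.
Proof.
rewrite /dotv (bigD1 l)//= mxE !eqxx mul1r big1 ?addr0// => k kl.
by rewrite mxE (negbTE kl) andbF mul0r.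
Qed.

Definition bform n (u : 'rV[R]_n) (A : 'M[R]_n) (v : 'rV[R]_n) : R :=
  (u *m A *m v^T) 0 0.

Lemma bformE n (u v : 'rV[R]_n) (A : 'M[R]_n) : bform u A v = dotv (u *m A) v.
Proof. by rewrite /bform mxE; apply: eq_bigr => l _; rewrite [v^T _ _]mxE. Qed.

Lemma qformE n (u : 'rV[R]_n) (A : 'M[R]_n) : qform u A = dotv (u *m A) u.
Proof. exact: bformE. Qed.

Lemma bformC n (u v : 'rV[R]_n) (A : 'M[R]_n) : A^T = A -> bform u A v = bform v A u.
Proof.
move=> AT; rewrite /bform -[in LHS]AT -[in LHS](trmxK u) -!trmx_mul mulmxA.
by rewrite mxE.
Qed.

Lemma qformD n (u v : 'rV[R]_n) (A : 'M[R]_n) : A^T = A ->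
  qform (u + v) A = qform u A + 2 * bform u A v + qform v A.
Proof.
move=> AT; rewrite !qformE mulmxDl dotvDl !dotvDr -!bformE (bformC v u AT); ring.
Qed.

Lemma qformN n (u : 'rV[R]_n) (A : 'M[R]_n) : qform (- u) A = qform u A.
Proof. by rewrite !qformE mulNmx dotvNl dotvNr opprK. Qed.

Lemma qformDm n (u : 'rV[R]_n) (A B : 'M[R]_n) : qform u (A + B) = qform u A + qform u B.
Proof. by rewrite !qformE mulmxDr dotvDl. Qed.

Lemma qform0 n (A : 'M[R]_n) : qform 0 A = 0.
Proof. by rewrite qformE dotvC dotv0l. Qed.

Lemma bformNr n (u v : 'rV[R]_n) (A : 'M[R]_n) : bform u A (- v) = - bform u A v.
Proof. by rewrite !bformE dotvNr. Qed.

Lemma bform_delta n (A : 'M[R]_n) (k l : 'I_n) :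
  bform (delta_mx 0 k) A (delta_mx 0 l) = A k l.
Proof. by rewrite bformE dotvC dotv_delta -rowE mxE. Qed.

(** * Inner product of two uncorrelated Gaussian vectors *)

Section GaussianInnerProduct.
Context dT (T : measurableType dT) (mu : {measure set T -> \bar R}).
Variables (D : set T) (mD : measurable D) (w : R).
Variables (d : nat) (x y : T -> 'rV[R]_d) (m : 'rV[R]_d) (A B : 'M[R]_d).
Hypotheses (AT : A^T = A) (BT : B^T = B).
Hypothesis gxy : forall r s, gaussian_moments mu D w
  (fun t => dotv r (x t) + dotv s (y t)) (dotv r m) (qform r A + qform s B).

(** Hypothesis [gxy] says, at the level of moments, that [x] has mean [m] and covariance [A], that
    [y] is centred with covariance [B], and that they are uncorrelated. Zero coefficients and the
    sign change of [s] supply the four inputs. *)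
Let uncorrelated r s :
  has_integral mu D (fun t => dotv r (x t) * dotv s (y t)) 0 /\
  has_integral mu D (fun t => dotv r (x t) ^+ 2 * dotv s (y t) ^+ 2)
    (w * (std_moment 2 * dotv r m ^+ 2 + std_moment 4 / 3 * qform r A) * qform s B).
Proof.
apply: has_integral_uncorrelated => //.
- apply: (gaussian_moments_ext _ _ _ (gxy r 0)) => [t|//|].
    by rewrite dotv0l addr0.
  by rewrite qform0 addr0.
- apply: (gaussian_moments_ext _ _ _ (gxy 0 s)) => [t||].
  + by rewrite dotv0l add0r.
  + exact: dotv0l.
  + by rewrite qform0 add0r.
- apply: (gaussian_moments_ext _ _ _ (gxy r (- s))) => [t|//|].
    by rewrite dotvNl.
  by rewrite qformN.
Qed.

(** Polarization in both pairs: $16\,a a' b b' = ((a+a')^2-(a-a')^2)((b+b')^2-(b-b')^2)$. *)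
Let has_integral_product4 r r' s s' :
  has_integral mu D
    (fun t => dotv r (x t) * dotv r' (x t) * (dotv s (y t) * dotv s' (y t)))
    (w * (std_moment 2 * (dotv r m * dotv r' m) + std_moment 4 / 3 * bform r A r')
     * bform s B s').
Proof.
have pp := (uncorrelated (r + r') (s + s')).2.
have pm := (uncorrelated (r + r') (s - s')).2.
have mp := (uncorrelated (r - r') (s + s')).2.
have mm := (uncorrelated (r - r') (s - s')).2.
apply: (has_integral_ext _ _ (has_integralD mD
  (has_integralD mD (has_integralZ mD (16^-1) pp) (has_integralZ mD (- 16^-1) pm))
  (has_integralD mD (has_integralZ mD (- 16^-1) mp) (has_integralZ mD (16^-1) mm)))).
  by move=> t; rewrite !dotvDl !dotvNl; field.
by rewrite !qformD// !qformN !bformNr !dotvDl !dotvNl; field.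
Qed.

Lemma has_integral_dotv : has_integral mu D (fun t => dotv (x t) (y t)) 0.
Proof.
apply: (has_integral_ext _ _ (has_integral_sum mD
  (fun l => (uncorrelated (delta_mx 0 l) (delta_mx 0 l)).1))).
  by move=> t; apply: eq_bigr => l _; rewrite !dotv_delta.
by rewrite big1.
Qed.

(** The square is the double sum of $x_k x_l y_k y_l$. With the true standard moments 1 and 3, the
    value is [w] times the pairing of the second-moment matrix of [x] with the covariance of [y]. *)
Lemma has_integral_dotv_sqr : has_integral mu D (fun t => dotv (x t) (y t) ^+ 2)
  (w * \sum_k \sum_l (std_moment 2 * (m 0 k * m 0 l) + std_moment 4 / 3 * A k l) * B k l).
Proof.
apply: (has_integral_ext _ _ (has_integral_sum mD (fun k => has_integral_sum mD
  (fun l => has_integral_product4 (delta_mx 0 k) (delta_mx 0 l)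
                                  (delta_mx 0 k) (delta_mx 0 l))))).
  move=> t; rewrite expr2 [in RHS]/dotv mulr_suml; apply: eq_bigr => k _.
  rewrite mulr_sumr; apply: eq_bigr => l _; rewrite !dotv_delta; ring.
rewrite mulr_sumr; apply: eq_bigr => k _; rewrite mulr_sumr; apply: eq_bigr => l _.
by rewrite !dotv_delta !bform_delta; ring.
Qed.

End GaussianInnerProduct.

(** * Spectral bounds *)

Lemma dotv_ge0 n (u : 'rV[R]_n) : 0 <= dotv u u.
Proof. by apply: sumr_ge0 => l _; rewrite -expr2 sqr_ge0. Qed.

Lemma sqr_normv n (u : 'rV[R]_n) : normv u ^+ 2 = dotv u u.
Proof. by rewrite sqr_sqrtr// dotv_ge0. Qed.

Lemma dotv_le_normv n (u v : 'rV[R]_n) : dotv u v <= normv u * normv v.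
Proof.
apply: (le_trans (ler_norm _)).
rewrite -(@ler_pXn2r _ 2) ?nnegrE ?normr_ge0 ?mulr_ge0 ?sqrtr_ge0//.
rewrite real_normK ?num_real// exprMn !sqr_normv /dotv.
under [X in _ <= X * _]eq_bigr do rewrite -expr2.
under [X in _ <= _ * X]eq_bigr do rewrite -expr2.
exact: sqr_sum_mul_le.
Qed.

(** Cauchy-Schwarz on each column; it bounds the set whose supremum is [spec_norm]. *)
Lemma normv_mulmx_le n (v : 'rV[R]_n) (A : 'M[R]_n) :
  normv (v *m A) <= frob A * normv v.
Proof.
rewrite -(@ler_pXn2r _ 2) ?nnegrE ?mulr_ge0 ?sqrtr_ge0//.
rewrite exprMn !sqr_normv sqr_frob /frob_inner exchange_big mulr_suml /=.
apply: ler_sum => l _; rewrite mxE -expr2.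
apply: (le_trans (sqr_sum_mul_le _ _)); rewrite mulrC le_eqVlt.
by apply/orP; left; apply/eqP; congr (_ * _); apply: eq_bigr => k _; rewrite expr2.
Qed.

Lemma normv_mulmx_spec_norm n (v : 'rV[R]_n) (A : 'M[R]_n) :
  normv v = 1 -> normv (v *m A) <= spec_norm A.
Proof.
move=> v1; apply: sup_upper_bound; last by exists v.
split; first by exists (normv (v *m A)); exists v.
by exists (frob A) => _ [u [u1 ->]]; rewrite -[frob A]mulr1 -u1 normv_mulmx_le.
Qed.

(** Rayleigh quotient: normalise [v], then apply Cauchy-Schwarz to [u *m A] and [u]. A vector of
    norm zero is treated apart. *)
Lemma qform_le_spec_norm n (v : 'rV[R]_n) (A : 'M[R]_n) (c : R) :
  spec_norm A <= c -> qform v A <= c * dotv v v.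
Proof.
move=> Ac; rewrite -sqr_normv.
have [v0|v_neq0] := eqVneq (normv v) 0.
  rewrite v0 expr0n mulr0 qformE (le_trans (dotv_le_normv _ _))//.
  by rewrite v0 mulr0.
have v_gt0 : 0 < normv v by rewrite lt_def v_neq0 sqrtr_ge0.
pose u := (normv v)^-1 *: v.
have uu : dotv u u = 1.
  by rewrite dotvZl dotvC dotvZl -sqr_normv; field.
have u1 : normv u = 1 by rewrite /normv uu sqrtr1.
have vu : v = normv v *: u by rewrite scalerA mulfV// scale1r.
rewrite [in leLHS]vu qformE -scalemxAl dotvZl dotvC dotvZl dotvC mulrA -expr2 mulrC.
rewrite ler_wpM2r ?sqr_ge0// (le_trans (dotv_le_normv _ _))// u1 mulr1.
exact: le_trans (normv_mulmx_spec_norm A u1) Ac.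
Qed.

Lemma normv_delta n (l : 'I_n) : normv (delta_mx 0 l : 'rV[R]_n) = 1.
Proof. by rewrite /normv dotv_delta mxE !eqxx sqrtr1. Qed.

(** A row is the image of a unit coordinate vector. *)
Lemma row_sqr_sum_le n (A : 'M[R]_n) (c : R) (l : 'I_n) :
  spec_norm A <= c -> \sum_k A l k ^+ 2 <= c ^+ 2.
Proof.
move=> Ac; have := normv_mulmx_spec_norm A (normv_delta l).
move=> /le_trans/(_ Ac) h.
have -> : \sum_k A l k ^+ 2 = normv (delta_mx 0 l *m A) ^+ 2.
  by rewrite sqr_normv -rowE; apply: eq_bigr => k _; rewrite mxE.
by rewrite ler_pXn2r// nnegrE ?sqrtr_ge0// (le_trans _ h)// sqrtr_ge0.
Qed.

Lemma spec_norm_bound_ge0 n (A : 'M[R]_n) (c : R) :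
  (0 < n)%N -> spec_norm A <= c -> 0 <= c.
Proof.
move=> n0 Ac; apply: le_trans Ac.
apply: le_trans (normv_mulmx_spec_norm A (normv_delta (Ordinal n0))).
exact: sqrtr_ge0.
Qed.

Lemma diag_le_spec_norm n (A : 'M[R]_n) (c : R) (l : 'I_n) :
  spec_norm A <= c -> A l l <= c.
Proof.
move=> /(qform_le_spec_norm (delta_mx 0 l)).
by rewrite -sqr_normv normv_delta expr1n mulr1 [qform _ _]bform_delta.
Qed.

(** Source of the linear growth in the dimension [n]: the signal covariance is a multiple of the
    identity, so its pairing with [A + B] is a trace, while the mean contributes a quadratic form
    bounded independently of [n]. *)
Lemma noise_signal_variance_le n (m : 'rV[R]_n) (A B : 'M[R]_n) (k2 k4 s c cmu : R) :
  (0 < n)%N -> 0 <= k2 -> 0 <= k4 -> 0 <= s -> 0 <= cmu ->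
  normv m <= cmu -> spec_norm A <= c -> spec_norm B <= c ->
  \sum_k \sum_l (k2 * (m 0 k * m 0 l) + k4 / 3 * (2 * s)%:M k l) * (A + B) k l <=
  (2 * k2 * c * cmu ^+ 2 + 4 / 3 * k4 * s * c) * n%:R.
Proof.
move=> n0 k20 k40 s0 cmu0 mc Ac Bc; have c0 := spec_norm_bound_ge0 n0 Ac.
have -> : \sum_k \sum_l (k2 * (m 0 k * m 0 l) + k4 / 3 * (2 * s)%:M k l) * (A + B) k l =
    k2 * qform m (A + B) + 2 / 3 * k4 * s * \sum_k (A + B) k k.
  have -> : qform m (A + B) = \sum_k \sum_l m 0 k * m 0 l * (A + B) k l.
    rewrite qformE /dotv exchange_big /=; apply: eq_bigr => l _.
    by rewrite mxE mulr_suml; apply: eq_bigr => k _; rewrite mulrAC.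
  rewrite !mulr_sumr -big_split /=; apply: eq_bigr => k _.
  under eq_bigr do rewrite mulrDl -mulrA.
  rewrite big_split /= -mulr_sumr; congr (_ + _).
  rewrite (bigD1 k)//= big1 ?addr0 => [|l lk].
    by rewrite [_%:M k k]mxE eqxx mulr1n; field.
  by rewrite [_%:M k l]mxE eq_sym (negbTE lk) mulr0n mulr0 mul0r.
have n1 : (1 : R) <= n%:R by rewrite ler1n.
have q1 : qform m (A + B) <= 2 * c * cmu ^+ 2.
  have mm : dotv m m <= cmu ^+ 2.
    by rewrite -sqr_normv ler_pXn2r// nnegrE ?sqrtr_ge0.
  have qA := qform_le_spec_norm m Ac; have qB := qform_le_spec_norm m Bc.
  by rewrite qformDm; have := ler_wpM2l c0 mm; lra.
have q2 : \sum_k (A + B) k k <= 2 * c * n%:R.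
  rewrite [leRHS](_ : _ = \sum_(k < n) (2 * c)); last first.
    by rewrite sumr_const card_ord mulr_natr.
  apply: ler_sum => k _.
  by rewrite mxE; have := diag_le_spec_norm k Ac; have := diag_le_spec_norm k Bc; lra.
rewrite [leRHS]mulrDl lerD//.
  (* The mean term is inflated by [1 <= n] to share the factor [n%:R]. *)
  apply: (@le_trans _ _ (k2 * (2 * c * cmu ^+ 2) * 1)); first by rewrite mulr1 ler_wpM2l.
  rewrite (_ : 2 * k2 * c * cmu ^+ 2 = k2 * (2 * c * cmu ^+ 2)); last by ring.
  by rewrite ler_wpM2l// mulr_ge0// mulr_ge0 ?sqr_ge0// mulr_ge0.
apply: (@le_trans _ _ (2 / 3 * k4 * s * (2 * c * n%:R))).
  by rewrite ler_wpM2l// !mulr_ge0// invr_ge0.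
by rewrite le_eqVlt; apply/orP; left; apply/eqP; field.
Qed.

(** Entrywise $2ab \le a^2+b^2$, after which each of the [n] rows contributes at most [c ^+ 2]. *)
Lemma noise_noise_variance_le n (A B : 'M[R]_n) (k2 k4 c : R) : 0 <= k4 ->
  spec_norm A <= c -> spec_norm B <= c ->
  \sum_k \sum_l (k2 * ((0 : 'rV[R]_n) 0 k * (0 : 'rV[R]_n) 0 l) + k4 / 3 * A k l) * B k l
  <= k4 / 3 * c ^+ 2 * n%:R.
Proof.
move=> k40 Ac Bc.
rewrite [leRHS](_ : _ = \sum_(k < n) (k4 / 3 * c ^+ 2)); last first.
  by rewrite sumr_const card_ord mulr_natr.
apply: ler_sum => k _.
have hA := row_sqr_sum_le k Ac; have hB := row_sqr_sum_le k Bc.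
apply: (@le_trans _ _ (k4 / 3 * (2^-1 * \sum_l A k l ^+ 2 + 2^-1 * \sum_l B k l ^+ 2))).
  rewrite !mulr_sumr -big_split mulr_sumr /=; apply: ler_sum => l _.
  rewrite !mxE mulr0 mulr0 add0r -mulrA ler_wpM2l ?divr_ge0//.
  by have := sqr_ge0 (A k l - B k l); nra.
by rewrite ler_wpM2l ?divr_ge0//; lra.
Qed.

(** * The noisy mixture model *)

(** Law of total expectation: [f] is the sum of its extensions by zero from the cells. *)
Lemma has_integral_partition d (T : measurableType d) (mu : {measure set T -> \bar R})
    (I : finType) (D : I -> set T) (f : T -> R) (r : I -> R) :
  (forall i, measurable (D i)) -> (forall t, exists i, D i t) ->
  (forall i j t, D i t -> D j t -> i = j) ->
  (forall i, has_integral mu (D i) f (r i)) ->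
  has_integral mu setT f (\sum_i r i).
Proof.
move=> mD cover disj fr.
have part i : has_integral mu setT (f \_ (D i)) (r i).
  have [fi fE] := fr i; have fDE := restrict_EFin f (D i).
  split; first by rewrite -fDE; apply/(integrable_mkcond _ (mD i)).1.
  rewrite -fE [RHS]integral_mkcond.
  by apply: eq_integral => t _; exact/esym/(congr1 (@^~ t) fDE).
apply: (has_integral_ext _ (erefl _) (has_integral_sum measurableT part)) => t.
have [i Dit] := cover t.
rewrite (bigD1 i)//= big1 ?addr0 => [|j ji]; first by rewrite patchE mem_set.
rewrite patchE memNset// => Djt; move: ji.
by rewrite (disj _ _ _ Djt Dit) eqxx.
Qed.

Lemma sum_two_points (I : finType) (V : nmodType) (i j : I) (F : I -> V) : i != j ->
  (forall k, k != i -> k != j -> F k = 0) -> \sum_k F k = F i + F j.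
Proof.
move=> ij F0; rewrite (bigD1 i)//= (bigD1 j) 1?eq_sym//= big1 ?addr0// => k /andP[ki kj].
exact: F0.
Qed.

Section NoisyMixture.
Context (dT : measure_display) (T : measurableType dT) (P : probability T R).
Variables (n d K : nat) (theta : 'I_K -> R) (mean : 'I_K -> 'rV[R]_d) (s2 : R).
Variables (Sig : 'I_K -> 'M[R]_d) (Z : 'I_n -> T -> 'I_K) (X eta : 'I_n -> T -> 'rV[R]_d).
Hypotheses (s2_ge0 : 0 <= s2) (theta0 : forall k, 0 <= theta k).
Hypothesis psdSig : forall k, psd (Sig k).
Hypothesis model : noisy_gmm_model P theta mean s2 Sig Z X eta.

(** Conditioning on the labels becomes restriction to this event, so no division by a possibly zero
    probability occurs. *)
Definition cluster_event (z : 'I_n -> 'I_K) := [set t | forall i, Z i t = z i].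
Definition cluster_weight (z : 'I_n -> 'I_K) := \prod_(i < n) theta (z i).

Lemma measurable_cluster_event z : measurable (cluster_event z).
Proof.
case: model => mZ _ _ _ _.
rewrite (_ : cluster_event z = \bigcap_(i in [set: 'I_n]) [set t | Z i t = z i]).
  by apply: fin_bigcap_measurable => // i _; exact: mZ.
by apply/seteqP; split => t h i; [move=> _|]; exact: h.
Qed.

Lemma measurable_dotv (u : 'rV[R]_d) (x : T -> 'rV[R]_d) :
  (forall l, measurable_fun setT (fun t => x t 0 l)) ->
  measurable_fun setT (fun t => dotv u (x t)).
Proof.
move=> mx; apply: measurable_sum => l.
by apply: measurable_funM => //; exact: measurable_cst.
Qed.

Lemma gaussian_moments_functional z (u v : 'I_n -> 'rV[R]_d) :
  gaussian_moments P (cluster_event z) (cluster_weight z)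
    (fun t => \sum_(i < n) (dotv (u i) (X i t) + dotv (v i) (eta i t)))
    (\sum_(i < n) dotv (u i) (mean (z i)))
    (\sum_(i < n) (s2 * dotv (u i) (u i) + qform (v i) (Sig (z i)))).
Proof.
case: (model) => mZ mX meta _ law.
have mD := measurable_cluster_event z.
set L := fun t => _; set m := \sum_(i < n) _; set V := \sum_(i < n) _.
have mL : measurable_fun setT L.
  by apply: measurable_sum => i; apply: measurable_funD; exact: measurable_dotv.
have w0 : 0 <= cluster_weight z by exact: prodr_ge0.
have V0 : 0 <= V.
  apply: sumr_ge0 => i _; rewrite addr_ge0//; last exact: (psdSig (z i)).2.
  by rewrite mulr_ge0// dotv_ge0.
have [i2 i4] := integral_restricted_gauss mD mL w0 V0 (law z u v).
split; apply: ge0_has_integral => //.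
- by apply: measurable_funTS; exact: measurable_funX.
- by move=> t; rewrite sqr_ge0.
- by apply: measurable_funTS; exact: measurable_funX.
- by move=> t; rewrite exprn_even_ge0.
Qed.

(** Coefficients supported on two samples, which specialise the model's functionals to a pair. *)
Let at_pair (i j : 'I_n) (a b : 'rV[R]_d) (k : 'I_n) : 'rV[R]_d :=
  if k == i then a else if k == j then b else 0.

Let sum_at_pair i j a b (F : 'I_n -> 'rV[R]_d -> R) : i != j ->
  (forall k, F k 0 = 0) -> \sum_k F k (at_pair i j a b k) = F i a + F j b.
Proof.
move=> ij F0; rewrite (sum_two_points ij) => [|k ki kj].
  by rewrite /at_pair eqxx eq_sym (negbTE ij) eqxx.
by rewrite /at_pair (negbTE ki) (negbTE kj) F0.
Qed.

(** Coefficients [r], [- r] on the signals and [s], [- s] on the noises: means subtract and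
    covariances add. *)
Lemma gaussian_moments_signal_noise z i j r s : i != j ->
  gaussian_moments P (cluster_event z) (cluster_weight z)
    (fun t => dotv r (X i t - X j t) + dotv s (eta i t - eta j t))
    (dotv r (mean (z i) - mean (z j)))
    (qform r (2 * s2)%:M + qform s (Sig (z i) + Sig (z j))).
Proof.
move=> ij; apply: (gaussian_moments_ext _ _ _ (gaussian_moments_functional z
  (at_pair i j r (- r)) (at_pair i j s (- s)))) => [t||].
- rewrite big_split /= (@sum_at_pair _ _ _ _ (fun k a => dotv a (X k t)) ij)//; last first.
    by move=> k; exact: dotv0l.
  rewrite (@sum_at_pair _ _ _ _ (fun k a => dotv a (eta k t)) ij)//; last first.
    by move=> k; exact: dotv0l.
  by rewrite !dotvNl !dotvDr !dotvNr.
- rewrite (@sum_at_pair _ _ _ _ (fun k a => dotv a (mean (z k))) ij)//; last first.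
    by move=> k; exact: dotv0l.
  by rewrite dotvNl dotvDr dotvNr.
- rewrite big_split /= (@sum_at_pair _ _ _ _ (fun k a => s2 * dotv a a) ij)//; last first.
    by move=> k; rewrite dotv0l mulr0.
  rewrite (@sum_at_pair _ _ _ _ (fun k a => qform a (Sig (z k))) ij)//; last first.
    by move=> k; exact: qform0.
  rewrite qformN qformDm (qformE r) mul_mx_scalar dotvZl dotvNl dotvNr opprK; ring.
Qed.

Lemma gaussian_moments_noise_noise z i j r s : i != j ->
  gaussian_moments P (cluster_event z) (cluster_weight z)
    (fun t => dotv r (eta i t) + dotv s (eta j t)) (dotv r 0)
    (qform r (Sig (z i)) + qform s (Sig (z j))).
Proof.
move=> ij; apply: (gaussian_moments_ext _ _ _ (gaussian_moments_functional z
  (fun=> 0) (at_pair i j r s))) => [t||].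
- rewrite big_split /= big1 ?add0r => [|k _]; last exact: dotv0l.
  by rewrite (@sum_at_pair _ _ _ _ (fun k a => dotv a (eta k t)) ij)// => k; exact: dotv0l.
- by rewrite dotvC dotv0l big1// => k _; exact: dotv0l.
- rewrite big_split /= big1 ?add0r => [|k _]; last by rewrite dotv0l mulr0.
  by rewrite (@sum_at_pair _ _ _ _ (fun k a => qform a (Sig (z k))) ij)// => k; exact: qform0.
Qed.

(** Distributivity turns the sum of products into a product of sums, each equal to 1. *)
Lemma sum_cluster_weight : \sum_k theta k = 1 ->
  \sum_(z : {ffun 'I_n -> 'I_K}) cluster_weight z = 1.
Proof.
move=> theta1; rewrite /cluster_weight -(bigA_distr_bigA (fun _ k => theta k)).
by rewrite big1.
Qed.

Lemma has_integral_clusters (f : T -> R) (r : {ffun 'I_n -> 'I_K} -> R) :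
  (forall z : {ffun 'I_n -> 'I_K}, has_integral P (cluster_event z) f (r z)) ->
  has_integral P setT f (\sum_z r z).
Proof.
apply: has_integral_partition.
- by move=> z; exact: measurable_cluster_event.
- by move=> t; exists [ffun i => Z i t] => i; rewrite ffunE.
- by move=> z z' t tz tz'; apply/ffunP => i; rewrite -tz -tz'.
Qed.

Definition cost_perturbation i j t : R :=
  2 * dotv (X i t - X j t) (eta i t - eta j t) - 2 * dotv (eta i t) (eta j t).

Lemma has_integral_cost_perturbation i j : i != j ->
  has_integral P setT (cost_perturbation i j) 0.
Proof.
move=> ij; apply: (has_integral_ext _ _ (has_integral_clusters (r := fun=> 0) _)) => //.
  by rewrite big1.
move=> z; have mD := measurable_cluster_event z.
have h1 := has_integral_dotv mD (fun r s => gaussian_moments_signal_noise z r s ij).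
have h2 := has_integral_dotv mD (fun r s => gaussian_moments_noise_noise z r s ij).
apply: (has_integral_ext _ _ (has_integralD mD (has_integralZ mD 2 h1)
  (has_integralZ mD (- 2) h2))); last by ring.
by move=> t; rewrite /cost_perturbation mulNr.
Qed.

(** The bound $(2p-2q)^2 \le 8p^2+8q^2$ separates the two inner products. Their second moments are
    bounded uniformly over the labels and averaged with the cluster weights. *)
Lemma integral_cost_perturbation_sqr_le (cmu c : R) i j : i != j ->
  (0 < d)%N -> \sum_k theta k = 1 -> 0 <= cmu ->
  (forall k k', normv (mean k - mean k') <= cmu) ->
  (forall k, spec_norm (Sig k) <= c) ->
  (\int[P]_t (cost_perturbation i j t ^+ 2)%:E <=
   (8 * (2 * std_moment 2 * c * cmu ^+ 2 + 4 / 3 * std_moment 4 * s2 * c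
         + std_moment 4 / 3 * c ^+ 2) * d%:R)%:E)%E.
Proof.
move=> ij d0 theta1 cmu0 hmean hSig.
pose f t := 8 * dotv (X i t - X j t) (eta i t - eta j t) ^+ 2
  + 8 * dotv (eta i t) (eta j t) ^+ 2.
have SigT k : (Sig k)^T = Sig k := (psdSig k).1.
have [r [rle hr]] : exists r, r <= 8 * (2 * std_moment 2 * c * cmu ^+ 2
    + 4 / 3 * std_moment 4 * s2 * c + std_moment 4 / 3 * c ^+ 2) * d%:R
    /\ has_integral P setT f r.
  (* The value [r] is left open and fixed by computing the integral first. *)
  eexists; split; last first.
    apply: has_integral_clusters => z; have mD := measurable_cluster_event z.
    have SSigT : (Sig (z i) + Sig (z j))^T = Sig (z i) + Sig (z j).
      by rewrite linearD /= !SigT.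
    exact: (has_integralD mD
      (has_integralZ mD 8 (has_integral_dotv_sqr mD (tr_scalar_mx _ _) SSigT
        (fun r s => gaussian_moments_signal_noise z r s ij)))
      (has_integralZ mD 8 (has_integral_dotv_sqr mD (SigT _) (SigT _)
        (fun r s => gaussian_moments_noise_noise z r s ij)))).
  rewrite -[leRHS]mul1r -[X in _ <= X * _](sum_cluster_weight theta1) mulr_suml.
  apply: ler_sum => z _.
  have k2 : 0 <= std_moment 2 by apply: std_moment_ge0; left.
  have k4 : 0 <= std_moment 4 by apply: std_moment_ge0; right.
  have w0 : 0 <= cluster_weight z by exact: prodr_ge0.
  have b1 := noise_signal_variance_le d0 k2 k4 s2_ge0 cmu0
    (hmean (z i) (z j)) (hSig (z i)) (hSig (z j)).
  have b2 := noise_noise_variance_le (std_moment 2) k4 (hSig (z i)) (hSig (z j)).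
  rewrite mulrCA [X in _ + X]mulrCA -mulrDr ler_wpM2l//.
  rewrite -mulrDr -mulrA ler_wpM2l// [leRHS]mulrDl; exact: lerD.
rewrite (le_trans _ (_ : (r%:E <= _)%E)) ?lee_fin//.
have [/integrableP[/measurable_EFinP mf _] <-] := hr.
have [/integrableP[/measurable_EFinP mE _] _] := has_integral_cost_perturbation ij.
apply: ge0_le_integral => //.
- by move=> t _; rewrite lee_fin sqr_ge0.
- by apply/measurable_EFinP; exact: measurable_funX.
- exact/measurable_EFinP.
- move=> t _; rewrite lee_fin /cost_perturbation /f.
  set p := dotv _ _; set q := dotv _ _.
  (* The gap between the two sides is [4 * (p + q) ^+ 2]. *)
  by have := sqr_ge0 (p + q); nra.
Qed.

End NoisyMixture.
End GaussianMixture.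

(** * Stability and moment bounds for the noisy mixture *)

Theorem theorem2 (R : realType) (Cmu CSig s2 : R) : 0 < s2 ->
  exists c : R,
  forall (n d K : nat) (theta : 'I_K -> R) (mu : 'I_K -> 'rV[R]_d)
    (Sig : 'I_K -> 'M[R]_d)
    (dT : measure_display) (T : measurableType dT) (P : probability T R)
    (Z : 'I_n -> T -> 'I_K) (X eta : 'I_n -> T -> 'rV[R]_d),
  (2 <= n)%N -> (1 <= d)%N -> (1 <= K)%N ->
  (forall k, 0 <= theta k) -> \sum_(k < K) theta k = 1 ->
  (forall k k', normv (mu k - mu k') <= Cmu) ->
  (forall k, psd (Sig k)) -> (forall k, spec_norm (Sig k) <= CSig) ->
  noisy_gmm_model P theta mu s2 Sig Z X eta ->
  let Y := fun i t => X i t + eta i t in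
  let C := fun t => \matrix_(i < n, j < n) (normv (Y i t - Y j t) ^+ 2) in
  let Ct := fun t => \matrix_(i < n, j < n) (normv (X i t - X j t) ^+ 2) in
  let E := fun t => \matrix_(i < n, j < n)
             (if i == j then 0
              else 2 * dotv (X i t - X j t) (eta i t - eta j t)
                   - 2 * dotv (eta i t) (eta j t)) in
  (forall (t : T) (eps : R), 0 < eps ->
     frob (pistar eps (C t) - pistar eps (Ct t)) <= frob (E t) / eps) /\
  (forall i j : 'I_n,
     [/\ P.-integrable setT (fun t => (E t i j)%:E),
         ('E_P[fun t => E t i j] = 0%:E)%E &
         ('E_P[fun t => (E t i j ^+ 2)%R] <= (c * d%:R)%:E)%E]).
Proof.
move=> s2_gt0; have s2_ge0 := ltW s2_gt0.
exists (8 * (2 * std_moment R 2 * CSig * Cmu ^+ 2 + 4 / 3 * std_moment R 4 * s2 * CSig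
         + std_moment R 4 / 3 * CSig ^+ 2)).
move=> n d K theta mu Sig dT T P Z X eta n2 d1 K1 theta0 theta1 hmu psdSig hSig model.
move=> Y C Ct E; split.
  (* The separable part of the cost is formed from the squared noise norms. *)
  move=> t eps eps0; apply: (@frob_pistar_le _ _ eps (C t) (Ct t) (E t)
    (fun i => normv (eta i t) ^+ 2)) => // i j ij.
  rewrite !mxE (negbTE ij) /Y !sqr_normv.
  move: (X i t) (X j t) (eta i t) (eta j t) => x x' e e'.
  rewrite !(dotvDl, dotvDr, dotvNl, dotvNr) (dotvC x' x) (dotvC e x) (dotvC e' x).
  rewrite (dotvC e x') (dotvC e' x') (dotvC e' e); ring.
have k0 : 'I_K := Ordinal K1.
have Cmu0 : 0 <= Cmu by apply: le_trans (hmu k0 k0); exact: sqrtr_ge0.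
have CSig0 := spec_norm_bound_ge0 d1 (hSig k0).
have EP (f : T -> R) : ('E_P[f] = \int[P]_t (f t)%:E)%E by rewrite unlock.
move=> i j; rewrite !EP.
(* On the diagonal [E] is zero, and only nonnegativity of the constant remains to be checked. *)
have [ij|ij] := eqVneq i j.
  have E0 t : E t i j = 0 by rewrite mxE ij eqxx.
  have -> : (fun t => (E t i j)%:E) = cst 0%:E by apply/funext => t; rewrite E0.
  split; first exact: integrable0.
    exact: integral0.
  under eq_integral do rewrite E0 expr0n /=.
  rewrite integral0 lee_fin mulr_ge0// mulr_ge0//.
  have k2 : 0 <= std_moment R 2 by apply: std_moment_ge0; left.
  have k4 : 0 <= std_moment R 4 by apply: std_moment_ge0; right.
  by rewrite !addr_ge0// !mulr_ge0// ?invr_ge0 ?sqr_ge0.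
have EE t : E t i j = cost_perturbation X eta i j t by rewrite mxE (negbTE ij).
have [Ei E0] := has_integral_cost_perturbation s2_ge0 theta0 psdSig model ij.
have -> : (fun t => (E t i j)%:E) = EFin \o cost_perturbation X eta i j.
  by apply/funext => t; rewrite EE.
split=> //.
under eq_integral do rewrite EE.
exact: (integral_cost_perturbation_sqr_le s2_ge0 theta0 psdSig model).
Qed.
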